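(* $b_{2,S_4}\leq 200^{5/18}\approx 4.36$.
   Context: For a positive integer $t$, $S_t$ denotes the star with $t$ edges (and $t+1$ vertices). For a positive integer $r$ and graphs $G,H$ (simple graphs), $c_{r,H}(G)$ is the number of $r$-edge-colorings of $G$ (functions $c:E(G)\to\{1,\dots,r\}$) with no monochromatic copy of $H$ as a subgraph. $c_{r,H}(n)$ is the maximum of $c_{r,H}(G)$ over all graphs $G$ on $n$ vertices. For connected $H$, the function $n\mapsto c_{r,H}(n)$ is supermultiplicative, so the limit $b_{r,H}=\lim_{n\to\infty} c_{r,H}(n)^{1/n}\in\mathbb{R}\cup\{\infty\}$ exists. *)

(* Defs.v *)
From HB Require Import structures.
From mathcomp Require Import all_boot all_order all_algebra.
From mathcomp Require Import all_classical all_reals all_analysis.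

Set Implicit Arguments.
Unset Strict Implicit.
Unset Printing Implicit Defensive.

Import Order.TTheory GRing.Theory Num.Theory.

Record sgraph (T : finType) := SGraph {
  edges :> {set {set T}};
  _ : [forall e in edges, #|e| == 2] }.

Section SgraphFinite.
Variable T : finType.
HB.instance Definition _ := [isSub for @edges T].
HB.instance Definition _ := [Finite of sgraph T by <:].
End SgraphFinite.

Definition edge (T : finType) (G : sgraph T) := {e : {set T} | e \in edges G}.

Lemma star_subproof (t : nat) :
  [forall e in [set [set ord0; lift ord0 i] | i : 'I_t], #|e| == 2].
Proof. by apply/forall_inP => _ /imsetP[i _ ->]; rewrite cards2 neq_lift. Qed.

(* The vertex [ord0] is the centre. *)
Definition star (t : nat) : sgraph 'I_t.+1 := SGraph (star_subproof t).

Definition coloring (r : nat) (T : finType) (G : sgraph T) :=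
  {ffun edge G -> 'I_r}.

(* A copy of [H] is given by an injection [f] on vertices mapping edges to
   edges; the copy need not be induced. *)
Definition mono_copy (r : nat) (U T : finType) (H : sgraph U) (G : sgraph T)
    (c : coloring r G) : bool :=
  [exists i : 'I_r, exists f : {ffun U -> T},
    injectiveb f &&
    [forall h in edges H, exists e : edge G,
      (val e == [set f u | u in h]) && (c e == i)]].

Definition num_colorings (r : nat) (U T : finType) (H : sgraph U)
    (G : sgraph T) : nat :=
  #|[set c : coloring r G | ~~ mono_copy H c]|.

Definition max_colorings (r : nat) (U : finType) (H : sgraph U) (n : nat) :
    nat :=
  \max_(G : sgraph 'I_n) num_colorings r H G.

Local Open Scope ring_scope.

Definition growth_seq (R : realType) (r : nat) (U : finType) (H : sgraph U)
    (n : nat) : \bar R :=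
  ((max_colorings r H n)%:R `^ n%:R^-1)%:E.

(* The limit lives in the extended reals, where it may be [+oo]; [lim] is
   meaningful only when [growth_seq] converges. *)
Definition growth (R : realType) (r : nat) (U : finType) (H : sgraph U) :
    \bar R :=
  limn (growth_seq R r H).

(* Main.v *)
(**
A red/blue edge colouring avoids a monochromatic S_4 iff every vertex meets at
most three edges of each colour.  Colour the edges uniformly at random and let
B_v be this event at v; its probability q depends only on the degree d of v:
q = 1 for d <= 3, then 7/8, 5/8, 5/16 for d = 4, 5, 6, and 0 for d >= 7.
For an edge uv the events B_u and B_v share only that edge, and swapping the
two colours shows that each is independent of its colour, so
P(B_u and B_v) = P(B_u) P(B_v).

Put x_v = 2, 1, 0 according to whether v has degree 5, 6 or at most 4.  Take
the event "B_u and B_v" with multiplicity x_u + x_v for every edge uv, and B_v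
with multiplicity 18 + x_v - sum_(u ~ v) (x_u + x_v), which is nonnegative.
Then every edge of the graph is relevant to exactly 36 of these events, and
the Shearer-Finner inequality gives
  P(all B_v)^36 <= prod_v q_v^(18 + x_v),
so that the number c of good colourings satisfies
  c^36 <= prod_v 2^(18 d_v) q_v^(18 + x_v) <= 200^(10 n),
with equality in each factor for degree 5.  The Shearer-Finner inequality is
proved by averaging over one edge at a time: by Hoelder, a pointwise inequality
f^k <= prod_i g_i^(m_i) survives averaging over a coordinate on which functions
g_i of total multiplicity exactly k depend.

Convergence is Fekete's lemma applied to ln c, disjoint unions making c
supermultiplicative.
*)
Require Import Defs.
From HB Require Import structures.
From mathcomp Require Import all_boot all_order all_algebra.
From mathcomp Require Import all_classical all_reals all_analysis.
From mathcomp Require Import ring lra zify.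
(* Restores the names that classical_sets shadows, such as subsetP. *)
Import mathcomp.boot.fintype mathcomp.boot.finset.
Import Order.TTheory GRing.Theory Num.Theory.
Import numFieldNormedType.Exports.

Set Implicit Arguments.
Unset Strict Implicit.
Unset Printing Implicit Defensive.

Local Open Scope ring_scope.

(** * Hoelder's inequality at two points *)

Section Hoelder.
Variable R : realType.

(** Plain AM-GM over the sigma type [J], in which each index [i] occurs [m i] times. *)
Lemma weighted_AGM (I : finType) (A : {pred I}) (m : I -> nat) (k : nat)
    (x : I -> R) :
  (\sum_(i in A) m i)%N = k -> (forall i, 0 <= x i) ->
  \prod_(i in A) x i ^+ m i <= ((\sum_(i in A) (m i)%:R * x i) / k%:R) ^+ k.
Proof.
move=> sum_m x_ge0; pose J : finType := {i : I & 'I_(m i)}.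
pose B : {pred J} := [pred p | tag p \in A].
have BE : B =i [pred p | (tag p \in A) && true] by move=> p; rewrite !inE andbT.
have cardB : #|B| = k.
  rewrite -sum1_card (eq_bigl _ _ BE) -sum_m.
  rewrite -(sig_big_dep _ (fun i (_ : 'I_(m i)) => true) (fun _ _ => 1%N)).
  by apply: eq_bigr => i _; rewrite sum1_card card_ord.
have prodE : \prod_(p in B) x (tag p) = \prod_(i in A) x i ^+ m i.
  rewrite (eq_bigl _ _ BE).
  rewrite -(sig_big_dep _ (fun i (_ : 'I_(m i)) => true) (fun i _ => x i)).
  by apply: eq_bigr => i _; rewrite -[in RHS](card_ord (m i)) -prodr_const.
have sumE : \sum_(p in B) x (tag p) = \sum_(i in A) (m i)%:R * x i.
  rewrite (eq_bigl _ _ BE).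
  rewrite -(sig_big_dep _ (fun i (_ : 'I_(m i)) => true) (fun i _ => x i)).
  apply: eq_bigr => i _.
  by rewrite mulr_natl -[in RHS](card_ord (m i)) -sumr_const.
have [+ _] := leif_AGM (A := B) (E :=
  fun p => x (tag p)) (fun p _ => x_ge0 (tag p)).
by rewrite cardB prodE sumE.
Qed.

(** Normalise by the averages [G i], with [r] the [k]-th root of their weighted product. AM-GM
    bounds [s0 / r] and [s1 / r] by weighted means over [A] of the ratios [g0 i / G i] and
    [g1 i / G i]; off [A] the ratios contribute a factor 1. *)
Lemma two_point_hoelder (I : finType) (A : {pred I}) (m : I -> nat) (k : nat)
    (g0 g1 : I -> R) (s0 s1 : R) :
  (0 < k)%N -> (\sum_(i in A) m i)%N = k ->
  (forall i, i \notin A -> g0 i = g1 i) ->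
  (forall i, 0 <= g0 i) -> (forall i, 0 <= g1 i) -> 0 <= s0 -> 0 <= s1 ->
  s0 ^+ k <= \prod_i g0 i ^+ m i -> s1 ^+ k <= \prod_i g1 i ^+ m i ->
  ((s0 + s1) / 2) ^+ k <= \prod_i ((g0 i + g1 i) / 2) ^+ m i.
Proof.
move=> k_gt0 sum_m g01 g0_ge0 g1_ge0 s0_ge0 s1_ge0 s0_le s1_le.
pose G i := (g0 i + g1 i) / 2.
have G_ge0 i : 0 <= G i by rewrite divr_ge0 ?addr_ge0.
have [/existsP[i /andP[mi_gt0 /eqP Gi0]]|] :=
    boolP [exists i, (0 < m i)%N && (G i == 0)].
  have [gi0 gi1] : g0 i = 0 /\ g1 i = 0.
    by have := g0_ge0 i; have := g1_ge0 i; move: Gi0; rewrite /G; split; lra.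
  have null (g : I -> R) (s : R) : g i = 0 -> 0 <= s ->
    s ^+ k <= \prod_j g j ^+ m j -> s = 0.
    move=> gi s_ge0; rewrite (bigD1 i)//= gi expr0n -[m i == _]negbK -lt0n
      mi_gt0.
    rewrite mul0r => s_le0; have: s ^+ k == 0 by rewrite eq_le s_le0 exprn_ge0.
    by rewrite expf_eq0 k_gt0 => /eqP.
  rewrite (null g0 s0)// (null g1 s1)// add0r mul0r expr0n -[k == _]negbK.
  by rewrite -lt0n k_gt0 /= prodr_ge0// => j _; exact/exprn_ge0/G_ge0.
rewrite negb_exists => /forallP G_neq0.
have {}G_neq0 i : m i != 0%N -> G i != 0.
  by move: (G_neq0 i); rewrite negb_and -lt0n => /orP[/negbTE->|].
pose P := \prod_i G i ^+ m i.
have P_gt0 : 0 < P.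
  apply: prodr_gt0 => i _; have [->|/G_neq0 Gi] := eqVneq (m i) 0%N;
    first by rewrite expr0.
  by rewrite exprn_gt0 // lt0r Gi G_ge0.
pose r := P `^ k%:R^-1.
have r_gt0 : 0 < r by exact: powR_gt0.
have rk : r ^+ k = P.
  rewrite -powR_mulrn ?powR_ge0// -powRrM mulVf ?powRr1 ?(ltW P_gt0)//.
  by rewrite pnatr_eq0 -lt0n.
have bound (g : I -> R) (s : R) : (forall i, 0 <= g i) ->
  (forall i, i \notin A -> g i = G i) ->
    0 <= s -> s ^+ k <= \prod_i g i ^+ m i ->
    s <= r * ((\sum_(i in A) (m i)%:R * (g i / G i)) / k%:R).
  move=> g_ge0 gG s_ge0 s_le; rewrite -ler_pdivrMl// mulrC.
  rewrite -(@ler_pXn2r _ k)// ?nnegrE ?divr_ge0 ?(ltW r_gt0)//; last first.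
    by apply: sumr_ge0 => i _; rewrite mulr_ge0// divr_ge0.
  rewrite expr_div_n rk ler_pdivrMr//; apply: le_trans s_le _.
  have -> : \prod_i g i ^+ m i = (\prod_(i in A) (g i / G i) ^+ m i) * P.
    rewrite [X in X * _]big_mkcond -big_split /=; apply: eq_bigr => i _.
    have [->|/G_neq0 Gi] := eqVneq (m i) 0%N;
      first by rewrite !expr0 if_same mulr1.
    by case: ifPn => [_|/gG->]; rewrite ?mul1r// -exprMn divfK.
  rewrite ler_pM2r//; by apply: weighted_AGM => // i; rewrite divr_ge0.
have gG i : i \notin A -> g0 i = G i /\ g1 i = G i.
  by move=> /g01; rewrite /G => ->; split; lra.
have := bound g0 s0 g0_ge0 (fun i h => (gG i h).1) s0_ge0 s0_le.
have := bound g1 s1 g1_ge0 (fun i h => (gG i h).2) s1_ge0 s1_le.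
set a1 := _ / k%:R; set a0 := _ / k%:R => le1 le0.
(* For each index of positive multiplicity the two ratios add up to 2, and the multiplicities over
   [A] sum to [k]. *)
have a01 : a0 + a1 = 2.
  rewrite /a0 /a1 -mulrDl -big_split /=.
  rewrite (eq_bigr (fun i => 2 * (m i)%:R)); last first.
    move=> i _; have [->|/G_neq0] := eqVneq (m i) 0%N;
      first by rewrite !mul0r addr0 mulr0.
    by rewrite /G => Gi; field; move: Gi; apply: contraNneq => ->;
      rewrite mul0r.
  by rewrite -mulr_sumr -natr_sum sum_m mulfK// pnatr_eq0 -lt0n.
rewrite -[leRHS]rk ler_pXn2r ?nnegrE ?divr_ge0 ?addr_ge0 ?(ltW r_gt0)//.
rewrite ler_pdivrMr//; apply: le_trans (lerD le0 le1) _.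
by rewrite -mulrDr a01.
Qed.

End Hoelder.

(** * Averaging over coordinates *)

Section AveragingOperators.
Variables (R : realType) (U : finType).
Implicit Types (f g : {set U} -> R) (e : U) (s : seq U) (X A : {set U}).

(** Sets are points of the discrete cube; this is the conditional expectation when a fair coin
    decides whether [e] belongs to the set. *)
Definition average e f X := (f (e |: X) + f (X :\ e)) / 2.

Definition averages s f := foldr average f s.

Definition indep e f := forall X, f (e |: X) = f (X :\ e).

Lemma average_indep e f : indep e f -> average e f = f.
Proof.
move=> fe; apply/funext => X; rewrite /average fe.
have -> : f (X :\ e) = f X.
  have [eX|eX] := boolP (e \in X); last first.
    by congr f; apply/setDidPl; rewrite disjoint_sym disjoints1.
  by rewrite -fe; congr f; apply/setUidPr; rewrite sub1set.
by field.
Qed.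

Lemma averageC e e' f : average e (average e' f) = average e' (average e f).
Proof.
have [->//|ee'] := eqVneq e e'; apply/funext => X; rewrite /average.
have comm (x y : U) Y : x != y -> y |: (Y :\ x) = (y |: Y) :\ x.
  move=> xy; apply/setP => z; rewrite !inE.
  by case: (eqVneq z y) => // ->; rewrite eq_sym xy.
rewrite (comm e e')// (comm e' e) 1?eq_sym//.
by rewrite (setUCA [set e']) !setDDl (setUC [set e'] [set e]); field.
Qed.

Lemma indep_average_self e f : indep e (average e f).
Proof.
move=> X; rewrite /average; congr ((f _ + f _) / 2); apply/setP => x;
by rewrite !inE; case: eqP.
Qed.

Lemma indep_average e e' f : indep e f -> indep e (average e' f).
Proof. by move=> /average_indep <-; rewrite averageC;
  exact: indep_average_self. Qed.

Lemma averages_cat s s' f : averages (s ++ s') f = averages s (averages s' f).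
Proof. exact: foldr_cat. Qed.

Lemma average_averages e s f : average e (averages s f) = averages s (average e
  f).
Proof. by elim: s => //= e' s IHs; rewrite averageC IHs. Qed.

Lemma averages_perm s s' f : perm_eq s s' -> averages s f = averages s' f.
Proof.
elim: s s' => [|e s IHs] s'; first by rewrite perm_sym => /perm_nilP ->.
move=> eq_ss'; have /splitPr s'e : e \in s' by rewrite -(perm_mem eq_ss')
  mem_head.
case: s'e eq_ss' => s1 s2; rewrite perm_sym perm_catC /= perm_cons perm_catC.
rewrite perm_sym => /IHs /= ->.
by rewrite !averages_cat /= average_averages.
Qed.

Lemma averages_cst s (a : R) : averages s (fun=> a) = fun=> a.
Proof. by elim: s => //= e s ->; rewrite average_indep. Qed.

Lemma averageM e f g : indep e f -> average e (f \* g) = f \* average e g.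
Proof.
move=> fe; apply/funext => X.
by rewrite -{2}(average_indep fe) /average /= !fe; field.
Qed.

Lemma averagesM s f g :
  {in s, forall e, indep e f} -> averages s (f \* g) = f \* averages s g.
Proof.
elim: s => //= e s IHs fs; rewrite IHs; last first.
  by move=> e' se'; apply: fs; rewrite inE se' orbT.
by rewrite averageM//; apply: fs; rewrite mem_head.
Qed.

Lemma average_ge0 e f : (forall X, 0 <= f X) -> forall X, 0 <= average e f X.
Proof. by move=> f_ge0 X; rewrite divr_ge0 ?addr_ge0. Qed.

Lemma sum_subsetsU1 e A f : e \notin A ->
  \sum_(X : {set U} | X \subset e |: A) f X =
  \sum_(X : {set U} | X \subset A) 2 * average e f X.
Proof.
move=> eA; rewrite (bigID [pred X : {set U} | e \in X]) /=.
rewrite (reindex_onto (fun X => e |: X) (fun X => X :\ e)) /=; last first.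
  by move=> X /andP[_ eX]; rewrite setD1K.
rewrite (eq_bigl (fun X : {set U} => X \subset A)); last first.
  move=> X; rewrite setU11 andbT; have [eX|eX] := boolP (e \in X).
    have -> : X \subset A = false by apply: contraNF eA => /subsetP; apply.
    apply/negbTE; rewrite negb_and; apply/orP; right.
    by apply: contraTN eX => /eqP <-; rewrite setD11.
  rewrite setU1K// eqxx andbT; apply/idP/idP => [|/(setUS [set e])//].
  by move=> /(setSD [set e]); rewrite !setU1K.
rewrite [X in _ + X](eq_bigl (fun X : {set U} => X \subset A)); last first.
  move=> X; apply/andP/idP => [[sX eX]|sX].
    by move: sX => /(setSD [set e]);
      rewrite setU1K// (setDidPl _)// disjoint_sym disjoints1.
  by rewrite (subset_trans sX (subsetUr _ _)); split=> //; apply: contra eA;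
    apply/subsetP.
rewrite -big_split /=; apply: eq_bigr => X sX; rewrite /average.
rewrite mulrC divfK ?pnatr_eq0//; congr (_ + f _).
by apply/esym/setDidPl; rewrite disjoint_sym disjoints1; apply: contra eA;
  apply/subsetP.
Qed.

(** Turns counting into probability. The argument [set0] fixes the coordinates outside [A] as
    absent. *)
Lemma sum_subsets A f :
  \sum_(X : {set U} | X \subset A) f X = 2 ^+ #|A| * averages (enum A) f set0.
Proof.
rewrite cardE -[in LHS](set_enum A).
elim: (enum A) (enum_uniq A) f => [_|e s IHs /= /andP[es s_uniq]] f.
  rewrite expr0 mul1r (big_pred1 set0)// => X.
  by rewrite set_nil subset0.
rewrite set_cons sum_subsetsU1 ?inE// -mulr_sumr IHs// average_averages.
by rewrite exprS mulrA.
Qed.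

(** The Shearer-Finner inequality, by induction on [s]. At coordinate [e], [two_point_hoelder]
    applies with [A] the indices whose domain contains [e]; the other functions stay independent of
    [e] after averaging over the rest of [s]. *)
Lemma averages_hoelder (I : finType) (m : I -> nat) (k : nat) (D : I -> {set U})
    (g : I -> {set U} -> R) f s :
  (0 < k)%N -> {in s, forall e, (\sum_(i | e \in D i) m i)%N = k} ->
  (forall i e, e \notin D i -> indep e (g i)) ->
  (forall i X, 0 <= g i X) -> (forall X, 0 <= f X) ->
  (forall X, f X ^+ k <= \prod_i g i X ^+ m i) ->
  forall X, averages s f X ^+ k <= \prod_i averages s (g i) X ^+ m i.
Proof.
move=> k_gt0; elim: s => //= e s IHs mk gD g_ge0 f_ge0 fg X.
have averages_ge0 h Y : (forall X, 0 <= h X) -> 0 <= averages s h Y.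
  by move=> h_ge0; elim: (s) Y => //= e' s' IH; exact: average_ge0.
have averages_le Y : averages s f Y ^+ k <= \prod_i averages s (g i) Y ^+ m i.
  by apply: IHs => // e' se'; apply: mk; rewrite inE se' orbT.
apply: (two_point_hoelder (A := [pred i | e \in D i])) => //.
- by apply: mk; rewrite mem_head.
- move=> i; rewrite inE => /gD gi; suff: indep e (averages s (g i)) by apply.
  by elim: (s) => //= e' s' IH; exact: indep_average.
- by move=> i; exact: averages_ge0.
- by move=> i; exact: averages_ge0.
- exact: averages_ge0.
- exact: averages_ge0.
Qed.

(** The effect of averaging over an element of [A] on a function [p] of the number of chosen
    elements of [A]: the coin adds 1 or 0 to the count of the others. *)
Definition mid (p : nat -> R) (n : nat) : R := (p n.+1 + p n) / 2.

Lemma midE p n : mid p n = (p n.+1 + p n) / 2.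
Proof. by []. Qed.

Lemma averages_card s A (p : nat -> R) : uniq s -> {subset s <= A} ->
  averages s (fun X => p #|X :&: A|) =
  fun X => iter (size s) mid p #|X :&: A :\: [set x in s]|.
Proof.
elim: s => [_ _|e s IHs /= /andP[es s_uniq] sA] /=.
  by apply/funext => X; rewrite set_nil setD0.
rewrite IHs// => [|x xs]; last by apply: sA; rewrite inE xs orbT.
have eA : e \in A by apply: sA; rewrite mem_head.
apply/funext => X; rewrite /average midE.
have -> : #|(e |: X) :&: A :\: [set x in s]| =
    #|X :&: A :\: [set x in e :: s]|.+1.
  rewrite (cardsD1 e) !inE eqxx eA es /= add1n; congr _.+1; apply: eq_card => x.
  by rewrite !inE; case: eqP => // _; rewrite /= andbA.
have -> // : #|(X :\ e) :&: A :\: [set x in s]| =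
    #|X :&: A :\: [set x in e :: s]|.
by apply: eq_card => x; rewrite !inE; case: eqP => //= _; rewrite ?andbF.
Qed.

Lemma card_setU1I A X e : e \notin A -> #|(e |: X) :&: A| = #|(X :\ e) :&: A|.
Proof.
move=> eA; apply: eq_card => x; rewrite !inE.
by case: eqP => //= ->; rewrite (negbTE eA) ?andbF.
Qed.

Lemma indep_card A (p : nat -> R) e : e \notin A ->
  indep e (fun X => p #|X :&: A|).
Proof. by move=> eA X; rewrite card_setU1I. Qed.

End AveragingOperators.

(** * Counting colorings *)

Section StarFreeColorings.
Variables (R : realType) (T : finType).
Implicit Types (E X A B : {set {set T}}) (e : {set T}) (v : T).

Definition incident E v := [set e in E | v \in e].

(* A vertex of degree [d] with [n] edges of one color is the center of no
   monochromatic [star 4]. *)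
Definition balanced (d n : nat) := (n < 4)%N && (d - n < 4)%N.

Definition balanced_at E v X := balanced #|incident E v| #|X :&: incident E v|.

Definition all_balanced E X := [forall v, balanced_at E v X].

(* The entries for [d > 6] are junk. *)
Definition balanced_prob (d : nat) : R :=
  match d with 4 => 7 / 8 | 5 => 5 / 8 | 6 => 5 / 16 | _ => 1 end.

(* The surplus multiplicity x of a vertex of degree [d]. *)
Definition excess (d : nat) : nat :=
  match d with 5 => 2 | 6 => 1 | _ => 0 end.

Lemma balanced_le6 d n : balanced d n -> (d <= 6)%N.
Proof. by rewrite /balanced; lia. Qed.

(* [n] is the color of one distinguished edge, of which the balance of the
   vertex is therefore independent. *)
Lemma iter_mid_balanced d n : (d < 6)%N -> (n <= 1)%N ->
  iter d (@mid R) (fun n => (balanced d.+1 n)%:R) n = balanced_prob d.+1.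
Proof.
move: d n => [|[|[|[|[|[|d]]]]]] [|[|n]] //= _ _;
  rewrite !midE /balanced /=; by field.
Qed.

Lemma averages_enumD A B (f : {set {set T}} -> R) : B \subset A ->
  averages (enum A) f = averages (enum (A :\: B)) (averages (enum B) f).
Proof.
move=> BA; rewrite -averages_cat; apply: averages_perm; apply: uniq_perm.
- exact: enum_uniq.
- rewrite cat_uniq !enum_uniq andbT /=; apply/hasPn => x.
  by rewrite !mem_enum inE => ->.
- move=> x; rewrite mem_cat !mem_enum inE.
  by case: (boolP (x \in B)) => [/(subsetP BA) ->|_]; rewrite ?orbF.
Qed.

(** The edge [e] is not averaged over, so the count left for [iter_mid_balanced] is 0 or 1. Both
    give the same value by the colour swap, hence a constant function. *)
Lemma averages_star A e : e \in A -> (#|A| <= 6)%N ->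
  averages (enum (A :\ e)) (fun X => (balanced #|A| #|X :&: A|)%:R) =
  fun=> balanced_prob #|A|.
Proof.
move=> eA A6; have cA : #|A| = #|A :\ e|.+1 by rewrite (cardsD1 e) eA.
rewrite (@averages_card _ _ _ A (fun n => (balanced #|A| n)%:R)) ?enum_uniq//;
  last first.
  by move=> x; rewrite mem_enum inE => /andP[].
apply/funext => X; rewrite -cardE cA iter_mid_balanced//; first by rewrite -cA.
rewrite -(cards1 e); apply: subset_leq_card; apply/subsetP => x.
by rewrite !inE mem_enum !inE; case: eqP; rewrite //= => _; case: (x \in A);
  rewrite ?andbF.
Qed.

Lemma averages_balanced_at E v : (#|incident E v| <= 6)%N ->
  averages (enum E) (fun X =>
    (balanced_at E v X)%:R) = fun=> balanced_prob #|incident E v|.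
Proof.
(* A vertex without edges has no edge to hold fixed; its event is certain and [balanced_prob 0] is
   1. *)
move=> d6; have [/eqP|[e eEv]] := set_0Vmem (incident E v).
  rewrite -cards_eq0 /balanced_at => /eqP d0;
    rewrite d0 -[RHS](averages_cst (enum E)).
  congr averages; apply/funext => X; rewrite /balanced sub0n andbT.
  suff -> : #|X :&: incident E v| = 0%N by [].
  by apply/eqP; rewrite -leqn0 -d0 subset_leq_card// subsetIr.
rewrite (@averages_enumD _ (incident E v :\ e));
  first by rewrite averages_star// averages_cst.
by apply/subsetP => x; rewrite !inE => /andP[_ /andP[]].
Qed.

(** Average first over the edges at [u] other than [e]: the event at [v] does not depend on them and
    factors out, while the event at [u] becomes constant. Then do the same at [v]; what remains is
    constant. *)
Lemma averages_balanced_at2 E u v : u != v -> [set u; v] \in E ->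
  {in E, forall e, #|e| = 2%N} ->
  (#|incident E u| <= 6)%N -> (#|incident E v| <= 6)%N ->
  averages (enum E) (fun X => (balanced_at E u X && balanced_at E v X)%:R) =
  fun=> balanced_prob #|incident E u| * balanced_prob #|incident E v|.
Proof.
move=> uv uvE E2 du dv; set e := [set u; v] in uvE *.
have eu : e \in incident E u by rewrite !inE uvE eqxx.
have ev : e \in incident E v by rewrite !inE uvE eqxx orbT.
have uv_e x : x \in incident E u -> x \in incident E v -> x = e.
  rewrite !inE => /andP[xE ux] /andP[_ vx]; apply/esym/eqP.
  by rewrite eqEcard subUset !sub1set ux vx E2// cards2 uv.
rewrite (@averages_enumD _ (incident E u :\ e)); last first.
  by apply/subsetP => x; rewrite !inE => /andP[_ /andP[]].
have -> : (fun X => (balanced_at E u X && balanced_at E v X)%:R) =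
    (fun X => (balanced_at E v X)%:R) \* (fun X =>
      (balanced_at E u X)%:R) :> (_ -> R).
  by apply/funext => X /=; rewrite -natrM mulnb andbC.
rewrite averagesM; last first.
  move=> x; rewrite mem_enum inE => /andP[]; rewrite inE => xe xu.
  apply: (@indep_card _ _ _ (fun n => (balanced #|incident E v| n)%:R)).
  by apply: contra xe => /(uv_e _ xu) ->.
rewrite averages_star// (@averages_enumD _ (incident E v :\ e)); last first.
  apply/subsetP => x; rewrite in_setD1 => /andP[xe xv].
  rewrite in_setD in_setD1 xe /=; apply/andP; split; last by move: xv;
    rewrite inE => /andP[].
  by apply: contra xe => /uv_e -> //.
have -> : (fun X => (balanced_at E v X)%:R) \*
    (fun=> balanced_prob #|incident E u|) =
    (fun=> balanced_prob #|incident E u|) \* (fun X => (balanced_at E v X)%:R).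
  by apply/funext => X /=; rewrite mulrC.
rewrite [averages (enum (_ :\ e)) _]averagesM// averages_star//.
exact: averages_cst.
Qed.

Lemma big_pair (S : Type) (idx : S) (op : Monoid.com_law idx) (u v : T)
    (F : T -> S) : u != v ->
  \big[op/idx]_(w in [set u; v]) F w = op (F u) (F v).
Proof.
by move=> uv; rewrite big_setU1 ?inE// big_set1.
Qed.

(** * The multiplicities and the resulting Shearer-Finner bound *)

Section Weights.
Variable E : {set {set T}}.
Hypothesis E2 : {in E, forall e, #|e| = 2%N}.
Hypothesis deg_le6 : forall v, (#|incident E v| <= 6)%N.

Let x v := excess #|incident E v|.
Let w e := (\sum_(v in e) x v)%N.
Let W v := (\sum_(e in incident E v) w e)%N.

(** Makes the truncated subtraction in [m] a true one. As [x] is at most 2, [W v] is at most d (x v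
    + 2) for a vertex of degree d, that is 20 = 18 + 2 for d = 5, 18 for d = 6 and at most 8
    otherwise. Degree 5 dictates the constant 18. *)
Lemma sum_weights_le v : (W v <= 18 + x v)%N.
Proof.
have wb e : e \in incident E v -> (w e <= x v + 2)%N.
  rewrite inE => /andP[eE ve]; have /eqP/cards2P[a [b [ab ee]]] := E2 eE.
  have x2 u : (x u <= 2)%N by rewrite /x; case: #|_| => [|[|[|[|[|[|[|?]]]]]]].
  move: ve; rewrite /w ee big_pair//= !inE => /orP[]/eqP ->; last rewrite addnC;
  by rewrite leq_add2l.
have {wb} : (W v <= #|incident E v| * (x v + 2))%N.
  by rewrite -sum_nat_const; apply: leq_sum.
move=> /leq_trans; apply; rewrite /x.
by move: (deg_le6 v); case: #|_| => [|[|[|[|[|[|[|?]]]]]]].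
Qed.

(** An index [inl v] is the event at [v], an index [inr e] the joint event at the ends of [e]; sets
    that are not edges get multiplicity 0. *)
Let m (i : T + {set T}) : nat :=
  match i with
  | inl v => 18 + x v - W v
  | inr e => if e \in E then w e else 0%N
  end.

Let D (i : T + {set T}) : {set {set T}} :=
  match i with
  | inl v => incident E v
  | inr e => \bigcup_(v in e) incident E v
  end.

(** Let [e0] join [a] and [b]. The sum [W a + W b] counts every edge meeting [e0] once and [e0]
    itself twice, and [w e0] is [x a + x b]. All weights therefore cancel against the two vertex
    terms, leaving 18 + 18. *)
Lemma sum_coverage e0 : e0 \in E -> (\sum_(i | e0 \in D i) m i)%N = 36%N.
Proof.
move=> e0E; have /eqP/cards2P[a [b [ab e0E']]] := E2 e0E.
rewrite big_sumType /=.
rewrite (eq_bigl (fun v => v \in [set a; b])); last first.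
  by move=> v; rewrite inE e0E -e0E'.
rewrite big_pair//=.
have -> : (\sum_(e | e0 \in D (inr e)) (if e \in E then w e else 0%N) =
    \sum_(e in E | (a \in e) || (b \in e)) w e)%N.
  rewrite -big_mkcondr /=; apply: eq_bigl => e.
  rewrite andbC; congr (_ && _); apply/bigcupP/idP => [[v ve]|].
    rewrite inE e0E /= e0E' !inE => /orP[]/eqP <-; by rewrite ve ?orbT.
  by case/orP => h; [exists a | exists b];
    rewrite // inE e0E e0E' !inE eqxx ?orbT.
have WE v : W v = (\sum_(e in E | v \in e) w e)%N.
  by apply: eq_bigl => e; rewrite inE.
have WW : (W a + W b =
    \sum_(e in E | (a \in e) || (b \in e)) w e + (x a + x b))%N.
  have -> : (x a + x b = \sum_(e in E | (a \in e) && (b \in e)) w e)%N.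
    rewrite (big_pred1 e0); first by rewrite /w e0E' big_pair.
    move=> e; apply/andP/eqP => [[eE /andP[ae be]]|->]; last first.
      by rewrite e0E e0E' !inE !eqxx orbT.
    apply/esym/eqP; rewrite eqEcard e0E' subUset !sub1set ae be E2//.
    by rewrite cards2 ab.
  rewrite !WE !big_mkcondr -!big_split /=; apply: eq_bigr => e _.
  by case: (a \in e); case: (b \in e); rewrite /= ?addn0 ?add0n.
by move: (sum_weights_le a) (sum_weights_le b) WW; lia.
Qed.

Lemma sum_degrees : (\sum_v #|incident E v| = 2 * #|E|)%N.
Proof.
under eq_bigr do rewrite -sum1_card big_mkcond /=.
rewrite exchange_big /= mulnC -sum_nat_const [RHS]big_mkcond /=.
apply: eq_bigr => e _; case: ifPn => eE.
  rewrite -(E2 eE) -sum1_card [RHS]big_mkcond; apply: eq_bigr => v _.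
  by rewrite inE eE.
by rewrite big1// => v _; rewrite inE (negbTE eE).
Qed.

Lemma balanced_prob_ge0 d : 0 <= balanced_prob d.
Proof. by case: d => [|[|[|[|[|[|[|?]]]]]]]; rewrite /balanced_prob; lra. Qed.

(** The source of 200: for d = 5 the left side is 2^90 (5/8)^20 = 2^30 5^20 = (2^3 5^2)^10. *)
Lemma vertex_bound d : (d <= 6)%N ->
  (2 ^+ 18) ^+ d * balanced_prob d ^+ (18 + excess d) <= 200 ^+ 10.
Proof.
by case: d => [|[|[|[|[|[|[|?]]]]]]] //= _; lra.
Qed.

Lemma card_all_balanced_bounded :
  (#|[set X : {set {set T}} | (X \subset E) && all_balanced E X]|%:R : R) ^+ 36
  <= (200 ^+ 10) ^+ #|T|.
Proof.
pose f X : R := (all_balanced E X)%:R.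
pose g (i : T + {set T}) X : R :=
  match i with
  | inl v => (balanced_at E v X)%:R
  | inr e => [forall v in e, balanced_at E v X]%:R
  end.
have balanced_atU1 v e X : e \notin incident E v ->
    balanced_at E v (e |: X) = balanced_at E v (X :\ e).
  by move=> ev; rewrite /balanced_at card_setU1I.
have g_indep i e : e \notin D i -> indep e (g i).
  case: i => [v|e'] eD X /=; first by rewrite balanced_atU1.
  congr (_%:R); congr nat_of_bool; apply: eq_forallb_in => v ve'.
  by rewrite balanced_atU1//; apply: contra eD => ev; apply/bigcupP; exists v.
have g_ge0 i X : 0 <= g i X by case: i => *; exact: ler0n.
(* All functions are indicators, and where [f] is 1 every [g i] is 1. *)
have f_le_g X : f X ^+ 36 <= \prod_i g i X ^+ m i.
  rewrite /f; have [/forallP gX|_] := boolP (all_balanced E X); last first.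
    by rewrite expr0n prodr_ge0// => i _; rewrite exprn_ge0.
  rewrite big1 ?expr1n// => -[v|e] _ /=; first by rewrite gX expr1n.
  by rewrite (_ : [forall v in e, _]) ?expr1n//; apply/forall_inP.
have f_ge0 X : 0 <= f X by exact: ler0n.
have mE : {in enum E, forall e, (\sum_(i | e \in D i) m i)%N = 36%N}.
  by move=> e; rewrite mem_enum; exact: sum_coverage.
have := averages_hoelder (k := 36%N) isT mE g_indep g_ge0 f_ge0 f_le_g set0.
rewrite big_sumType /=.
under eq_bigr do rewrite averages_balanced_at//.
have -> : \prod_e averages (enum E) (g (inr e)) set0 ^+ m (inr e) =
    \prod_(e in E) \prod_(v in e) balanced_prob #|incident E v| ^+ w e.
  rewrite [RHS]big_mkcond; apply: eq_bigr => e _ /=.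
  case: ifPn => [eE|]; last by rewrite expr0.
  have /eqP/cards2P[a [b [ab ee]]] := E2 eE.
  rewrite ee big_pair//= -exprMn -ee; congr (_ ^+ _).
  transitivity (averages (enum E) (fun X =>
    (balanced_at E a X && balanced_at E b X)%:R : R) set0).
    congr (averages _ _ _); apply/funext => X.
    congr (_%:R); congr nat_of_bool; apply/forall_inP/andP => [h|[ha hb] v].
      by split; apply: h; rewrite ee !inE eqxx ?orbT.
    by rewrite ee !inE => /orP[]/eqP ->.
  by rewrite averages_balanced_at2// -ee.
(* Regrouped by vertices, the edge factors give exponent [W v] at [v], which restores what
   [m (inl v)] had subtracted and leaves [18 + x v]. *)
have -> : \prod_(e in E) \prod_(v in e) balanced_prob #|incident E v| ^+ w e =
    \prod_v balanced_prob #|incident E v| ^+ W v.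
  rewrite (exchange_big_dep xpredT)//=; apply: eq_bigr => v _.
  by rewrite -prodrXr; apply: eq_bigl => e; rewrite inE.
rewrite -big_split /=.
under eq_bigr => v _ do rewrite -exprD subnK ?sum_weights_le//.
move=> f_le.
have -> : #|[set X : {set {set T}} | (X \subset E) && all_balanced E X]|%:R =
    2 ^+ #|E| * averages (enum E) f set0 :> R.
  rewrite -sum_subsets -sum1_card natr_sum big_mkcond [RHS]big_mkcond /=.
  by apply: eq_bigr => X _; rewrite inE /f; case: (_ \subset _);
    case: all_balanced.
rewrite exprMn; apply: le_trans (ler_wpM2l _ f_le) _;
  first by rewrite !exprn_ge0.
have -> : (2 ^+ #|E|) ^+ 36 = \prod_v (2 ^+ 18) ^+ #|incident E v| :> R.
  by rewrite prodrXr sum_degrees -!exprM; congr (_ ^+ _); lia.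
rewrite -big_split /= -prodr_const; apply: ler_prod => v _.
rewrite mulr_ge0 ?exprn_ge0 ?balanced_prob_ge0//=.
exact: vertex_bound.
Qed.

End Weights.

Lemma card_all_balanced_le E : {in E, forall e, #|e| = 2%N} ->
  (#|[set X : {set {set T}} | (X \subset E) && all_balanced E X]|%:R : R) ^+ 36
  <= (200 ^+ 10) ^+ #|T|.
Proof.
move=> E2; have [/forallP|] := boolP [forall v, (#|incident E v| <= 6)%N].
  exact: card_all_balanced_bounded.
rewrite negb_forall => /existsP[v dv].
(* A vertex of degree at least 7 is never balanced, so the count is 0. *)
rewrite (_ : [set _ | _] = set0) ?cards0 ?expr0n ?exprn_ge0//.
apply/setP => X; rewrite !inE; apply: contraNF dv => /andP[_ /forallP/(_ v)].
exact: balanced_le6.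
Qed.

End StarFreeColorings.

(** * Monochromatic stars and the encoding of colourings by edge sets *)

Section Stars.
Variables (T : finType) (G : sgraph T).
Implicit Types (v : T) (c : coloring 2 G) (X : {set {set T}}).

Lemma sgraph_card2 : {in edges G, forall e : {set T}, #|e| = 2%N}.
Proof. by case: G => E /= /forall_inP E2 e /E2/eqP. Qed.

(** Forward, injectivity of the embedding makes the images of the star's edges distinct. Backward,
    leaf [j] goes to the other end [w j] of the [j]-th chosen edge at [v]; distinct edges at [v]
    have distinct other ends. *)
Lemma mono_starP (t r : nat) (c : coloring r G) :
  reflect (exists i v, (t <=
    #|[set e : edge G | (v \in val e) && (c e == i)]|)%N)
    (mono_copy (star t) c).
Proof.
apply: (iffP existsP) =>
  [[i /existsP[f /andP[/injectiveP f_inj /forall_inP fh]]]|].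
  exists i, (f ord0); pose h (j : 'I_t) : {set 'I_t.+1} :=
    [set ord0; lift ord0 j].
  have ex j : exists e : edge G, (val e == [set f u | u in h j]) && (c e == i).
    by apply/existsP/fh/imsetP; exists j.
  pose k j := xchoose (ex j).
  have kE j : val (k j) = [set f ord0; f (lift ord0 j)].
    have /andP[/eqP -> _] := xchooseP (ex j).
    by rewrite /h imsetU !imset_set1.
  have k_inj : injective k.
    move=> a b /(congr1 val); rewrite !kE => /setP/(_ (f (lift ord0 a))).
    rewrite !inE eqxx orbT => /esym/orP[]/eqP/f_inj; last exact: lift_inj.
    by move=> h0; have := neq_lift ord0 a; rewrite h0 eqxx.
  rewrite -[X in (X <= _)%N](card_ord t) -(card_imset _ k_inj)
    subset_leq_card//.
  apply/subsetP => _ /imsetP[j _ ->]; have /andP[_ ci] := xchooseP (ex j).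
  have fk : f ord0 \in val (k j) by rewrite kE !inE eqxx.
  by rewrite inE; apply/andP.
move=> [i [v]]; set S := [set e | _] => tS; exists i; apply/existsP.
have eS (j : 'I_t) : enum_val (widen_ord tS j) \in S by exact: enum_valP.
pose k j := enum_val (widen_ord tS j).
have ex (j : 'I_t) : exists w, (v != w) && (val (k j) == [set v; w]).
  have := eS j; rewrite inE => /andP[vk _].
  have /cards2P[a [b [ab kab]]] : #|val (k j)| == 2%N by rewrite
    sgraph_card2//; exact: valP.
  move: vk; rewrite -/(k j) kab !inE => /orP[]/eqP ->; [exists b|exists a].
    by rewrite ab eqxx.
  by rewrite eq_sym ab setUC eqxx.
pose w j := xchoose (ex j).
have vw j : v != w j by have /andP[] := xchooseP (ex j).
have kw j : val (k j) = [set v; w j] by have /andP[_ /eqP] := xchooseP (ex j).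
have w_inj : injective w.
  move=> a b wab; have /val_inj/enum_val_inj : val (k a) = val (k b) by rewrite
    !kw wab.
  by move=> /(congr1 val) /= /val_inj.
pose f : {ffun 'I_t.+1 -> T} := [ffun u => oapp w v (unlift ord0 u)].
have f0 : f ord0 = v by rewrite ffunE unlift_none.
have fl j : f (lift ord0 j) = w j by rewrite ffunE liftK.
exists f; apply/andP; split.
  apply/injectiveP => a b.
  case: (unliftP ord0 a) => [a' ->|->]; case: (unliftP ord0 b) => [b' ->|->] //.
  - by rewrite !fl => /w_inj ->.
  - by rewrite fl f0 => /esym/eqP; rewrite (negbTE (vw _)).
  - by rewrite fl f0 => /eqP; rewrite (negbTE (vw _)).
apply/forall_inP => _ /imsetP[j _ ->]; apply/existsP; exists (k j).
rewrite imsetU !imset_set1 f0 fl -kw eqxx /=.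
by have := eS j; rewrite inE => /andP[].
Qed.

(* Two-colorings are encoded by the set of edges of color 0. *)
Definition color_class0 c : {set {set T}} :=
  [set val e | e : edge G & c e == ord0].

(** The map [color_class0] is a bijection onto the subsets of the edge set. The edges of colour 1 at
    a vertex number its degree minus those of colour 0, which matches the two conditions in
    [balanced]. *)
Lemma num_colorings_all_balanced :
  num_colorings 2 (star 4) G =
  #|[set X : {set {set T}} | (X \subset edges G) && all_balanced (edges G) X]|.
Proof.
have class0E c (e : edge G) : (val e \in color_class0 c) = (c e == ord0).
  by rewrite mem_imset ?inE//; exact: val_inj.
have class0_inj : injective color_class0.
  move=> c c' cc'; apply/ffunP => e; move: (class0E c e); rewrite cc' class0E.
  by case: (c e) (c' e) => [[|[|?]] ?] [[|[|?]] ?] // _; exact: val_inj.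
have sub0 c : color_class0 c \subset edges G.
  by apply/subsetP => _ /imsetP[e _ ->]; exact: valP.
have card0 c v : #|[set e : edge G | (v \in val e) && (c e == ord0)]| =
    #|color_class0 c :&: incident (edges G) v|.
  rewrite -(card_imset _ val_inj); apply: eq_card => x; apply/imsetP/idP.
    move=> [e]; rewrite inE => /andP[ve ce] ->.
    by rewrite !inE class0E ce ve andbT; exact: valP.
  rewrite !inE => /and3P[/imsetP[e]]; rewrite inE => ce -> _ ve.
  by exists e; rewrite ?inE ?ve.
have card1 c v : #|[set e : edge G | (v \in val e) && (c e == ord_max)]| =
    (#|incident (edges G) v| - #|color_class0 c :&: incident (edges G) v|)%N.
  have -> : #|incident (edges G) v| = #|[set e : edge G | v \in val e]|.
    rewrite -[RHS](card_imset _ val_inj); apply: eq_card => x; apply/idP/imsetP.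
      by rewrite inE => /andP[xG vx]; exists (Sub x xG); rewrite ?inE ?SubK.
    by move=> [e]; rewrite inE => ve ->; rewrite inE ve andbT; exact: valP.
  rewrite -card0 -(cardsID [set e : edge G | c e == ord0] [set e : edge G | v
    \in val e]).
  have -> : [set e : edge G | (v \in val e) && (c e == ord0)] =
      [set e : edge G | v \in val e] :&: [set e : edge G | c e == ord0].
    by apply/setP => e; rewrite !inE.
  rewrite addKn; apply: eq_card => e; rewrite !inE andbC.
  by congr (_ && _); case: (c e) => [[|[|?]] ?].
have all_balancedE c : ~~ mono_copy (star 4) c = all_balanced (edges G)
  (color_class0 c).
  apply/idP/forallP => [mono v|balanced_c].
    rewrite /balanced_at /balanced -card1 -card0 !ltnNge -negb_or;
      apply: contra mono.
    by case/orP; rewrite -ltnNge => h; apply/mono_starP;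
      [exists ord0, v | exists ord_max, v].
  apply/mono_starP => -[i [v]]; have := balanced_c v.
  rewrite /balanced_at /balanced -card1 -card0 => /andP[h0 h1].
  have [->|->] : i = ord0 \/ i = ord_max.
    by case: i => [[|[|?]] ?] //; [left|right]; exact: val_inj.
  - by rewrite leqNgt h0.
  - by rewrite leqNgt h1.
rewrite /num_colorings -(card_imset _ class0_inj); apply: eq_card => X.
rewrite inE; apply/imsetP/andP => [[c]|[XG Xbal]].
  by rewrite inE all_balancedE => ? ->.
pose c : coloring 2 G := [ffun e => if val e \in X then ord0 else ord_max].
have cX : color_class0 c = X.
  apply/setP => x; apply/imsetP/idP => [[e]|xX].
    by rewrite inE ffunE => + ->; case: ifP.
  by exists (Sub x (subsetP XG _ xX)); rewrite ?inE ?ffunE SubK ?xX.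
by exists c; rewrite ?inE ?all_balancedE ?cX.
Qed.

End Stars.

(** * Supermultiplicativity *)

Section DisjointUnion.
Variables (T1 T2 T : finType) (f : T1 -> T) (g : T2 -> T).
Hypotheses (f_inj : injective f) (fg_disj : forall a b, f a <> g b).
Implicit Types (E X : {set {set T1}}) (F Y : {set {set T2}}).

Definition union_edges E F : {set {set T}} :=
  [set f @: e | e : {set T1} in E] :|: [set g @: e | e : {set T2} in F].

(** A point of [e] has an image under [f] lying in no image under [g]. Only the empty set has the
    same image under both maps. *)
Lemma union_edges_l E F (e : {set T1}) : e != set0 ->
  (f @: e \in union_edges E F) = (e \in E).
Proof.
move=> /set0Pn[a ae]; rewrite inE mem_imset; last exact: imset_inj.
case: (e \in E) => //=; apply/imsetP => -[e' _ /setP/(_ (f a))].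
by rewrite imset_f// => /esym/imsetP[b _ /fg_disj].
Qed.

Lemma balanced_at_union_l E F X Y a :
  balanced_at (union_edges E F) (f a) (union_edges X Y) = balanced_at E a X.
Proof.
have h (e : {set T1}) : (f a \in f @: e) = (a \in e) by exact: mem_imset.
have h' (e : {set T2}) : f a \in g @: e = false.
  by apply/negbTE/imsetP => -[b _ /fg_disj].
have incidentE Z F0 : [set e in union_edges Z F0 | f a \in e] =
    (fun e : {set T1} => f @: e) @: [set e in Z | a \in e].
  apply/setP => e; rewrite inE inE; apply/andP/imsetP.
    move=> [/orP[/imsetP[e1 e1Z ->]|/imsetP[e1 _ ->]]]; last by rewrite h'.
    by rewrite h => ae; exists e1; rewrite // inE e1Z.
  by move=> [e1]; rewrite inE => /andP[e1Z ae] ->; rewrite h imset_f.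
rewrite /balanced_at; congr balanced;
  first by rewrite /incident incidentE card_imset//; exact: imset_inj.
rewrite /incident incidentE.
have -> : union_edges X Y :&: [set f @: e | e : {set T1} in [set e in E | a \in
  e]] =
    [set f @: e | e : {set T1} in X :&: [set e in E | a \in e]].
  apply/setP => e; rewrite inE; apply/andP/imsetP.
    move=> [eX /imsetP[e1 e1E ee]]; exists e1 => //; rewrite inE e1E andbT.
    move: eX; rewrite ee union_edges_l//; apply/set0Pn; exists a.
    by move: e1E; rewrite inE => /andP[].
  move=> [e1]; rewrite inE => /andP[e1X e1E] ->; split; last exact: imset_f.
  by rewrite inE imset_f.
by rewrite card_imset//; exact: imset_inj.
Qed.

End DisjointUnion.

(** Transfers the facts about the left summand to the right one. *)
Lemma union_edgesC (T1 T2 T : finType) (f : T1 -> T) (g : T2 -> T) E F :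
  union_edges f g E F = union_edges g f F E.
Proof. exact: setUC. Qed.

Lemma empty_sgraph_subproof (T : finType) :
  [forall e in (set0 : {set {set T}}), #|e| == 2].
Proof. by apply/forall_inP => e; rewrite inE. Qed.

Definition empty_sgraph (T : finType) := SGraph (empty_sgraph_subproof T).

Lemma max_coloringsP r (U : finType) (H : sgraph U) n :
  exists G : sgraph 'I_n, max_colorings r H n = num_colorings r H G.
Proof.
rewrite /max_colorings;
  have [|G ->] := @bigop.eq_bigmax (sgraph 'I_n) (num_colorings r H);
    last by exists G.
by apply/card_gt0P; exists (empty_sgraph _).
Qed.

Lemma max_colorings_supermultiplicative m n :
  (max_colorings 2 (star 4) m * max_colorings 2 (star 4) n <=
   max_colorings 2 (star 4) (m + n))%N.
Proof.
have [G1 ->] := max_coloringsP 2 (star 4) m.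
have [G2 ->] := max_coloringsP 2 (star 4) n.
pose f := @lshift m n; pose g := @rshift m n.
have f_inj : injective f by exact: lshift_inj.
have g_inj : injective g by exact: rshift_inj.
have fg a b : f a <> g b by apply/eqP; rewrite eq_lrshift.
have gf a b : g a <> f b by apply/eqP; rewrite eq_rlshift.
pose E := union_edges f g (edges G1) (edges G2).
have E2 : [forall e in E, #|e| == 2].
  apply/forall_inP => e; rewrite inE => /orP[] /imsetP[e' e'G ->].
    by rewrite card_imset// (sgraph_card2 e'G).
  by rewrite card_imset// (sgraph_card2 e'G).
apply: leq_trans (bigop.leq_bigmax (SGraph E2)).
rewrite !num_colorings_all_balanced -cardsX.
pose h (p : {set {set 'I_m}} * {set {set 'I_n}}) := union_edges f g p.1 p.2.
have ne (k : nat) (G : sgraph 'I_k) (X : {set {set 'I_k}}) e :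
    X \subset edges G -> e \in X -> e != set0.
  move=> /subsetP XG /XG /sgraph_card2 e2.
  by rewrite -card_gt0 e2.
(* Injectivity: each part is recovered from the union by [union_edges_l], its members being edges
   and so nonempty. *)
rewrite -(card_in_imset (f := h)); last first.
  move=> [X1 X2] [Y1 Y2]; rewrite !inE /= => /andP[/andP[X1G _] /andP[X2G _]].
  move=> /andP[/andP[Y1G _] /andP[Y2G _]]; rewrite /h /= => hE.
  congr pair; apply/setP => e; apply/idP/idP => eZ.
  - by rewrite -(union_edges_l f_inj fg _ Y2) ?(ne _ _ _ _ X1G)// -hE inE
    imset_f.
  - by rewrite -(union_edges_l f_inj fg _ X2) ?(ne _ _ _ _ Y1G)// hE inE
    imset_f.
  - rewrite -(union_edges_l g_inj gf _ Y1) ?(ne _ _ _ _ X2G)// union_edgesC -hE.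
    by rewrite inE (imset_f (fun e : {set _} => g @: e)) ?orbT.
  - rewrite -(union_edges_l g_inj gf _ X1) ?(ne _ _ _ _ Y2G)// union_edgesC hE.
    by rewrite inE (imset_f (fun e : {set _} => g @: e)) ?orbT.
apply: subset_leq_card; apply/subsetP => Z /imsetP[[X1 X2]].
rewrite !inE /= => /andP[/andP[X1G /forallP g1] /andP[X2G /forallP g2]] ->.
apply/andP; split; first by apply: setUSS; exact: imsetS.
apply/forallP => v; case: (split_ordP v) => [a|b] ->.
  by rewrite /E /h balanced_at_union_l.
by rewrite /E /h union_edgesC [X in balanced_at _ _ X]union_edgesC
  balanced_at_union_l.
Qed.

Lemma max_colorings_gt0 n : (0 < max_colorings 2 (star 4) n)%N.
Proof.
apply: leq_trans (bigop.leq_bigmax (empty_sgraph _));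
  rewrite num_colorings_all_balanced.
apply/card_gt0P; exists set0; rewrite inE sub0set; apply/forallP => v.
rewrite /balanced_at /balanced set0I cards0 subn0 /= (_ : incident _ _ = set0)
  ?cards0//.
by apply/setP => e; rewrite !inE.
Qed.

Lemma max_colorings_le (R : realType) n :
  ((max_colorings 2 (star 4) n)%:R : R) ^+ 36 <= (200 ^+ 10) ^+ n.
Proof.
have [G ->] := max_coloringsP 2 (star 4) n.
rewrite num_colorings_all_balanced -[X in _ <= _ ^+ X](card_ord n).
exact/card_all_balanced_le/sgraph_card2.
Qed.

(** * Growth rates *)

Section Growth.
Variable R : realType.

(** Fekete's lemma; the limit is the supremum of the quotients. *)
Lemma superadditive_cvg (u : nat -> R) (C : R) :
  (forall n, 0 <= u n) -> (forall m n, u m + u n <= u (m + n)%N) ->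
  (forall n, u n <= n%:R * C) ->
  cvgn (fun n => u n / n%:R).
Proof.
move=> u_ge0 u_super u_le.
pose A := [set x | exists2 n, (0 < n)%N & x = u n / n%:R]%classic.
have A_ub : has_ubound A.
  exists C => _ [n n_gt0 ->].
  by rewrite ler_pdivrMr ?ltr0n// mulrC.
have A_sup : has_sup A by split=> //; exists (u 1%N / 1); exists 1%N.
have u_mul q m : q%:R * u m <= u (q * m)%N.
  elim: q => [|q IHq]; first by rewrite mul0r.
  rewrite mulSn -natr1 mulrDl mul1r addrC.
  exact: le_trans (lerD (lexx _) IHq) (u_super _ _).
apply/cvg_ex; exists (sup A); apply/cvgrPdist_le => /= e e_gt0.
have [_ [m m_gt0 ->] sup_lt] := sup_adherent (divr_gt0 e_gt0 (ltr0n R 2)) A_sup.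
have m_neq0 : m%:R != 0 :> R by rewrite pnatr_eq0 -lt0n.
near=> n.
have n_gt0 : (0 < n)%N by near: n; exact: nbhs_infty_gt.
have n_gt0R : 0 < n%:R :> R by rewrite ltr0n.
have un_le : u n / n%:R <= sup A by apply: ub_le_sup => //; exists n.
rewrite ger0_norm ?subr_ge0//.
(* Write n = q m + r with r < m: then [u n] is at least q [u m], dropping [u r] by nonnegativity,
   and q + 1 exceeds n / m. *)
have un_ge : u m / m%:R - u m / n%:R <= u n / n%:R.
  rewrite ler_pdivlMr// mulrBl divfK ?gt_eqF//.
  have : u m / m%:R * n%:R <= (n %/ m)%:R * u m + u m.
    rewrite mulrAC ler_pdivrMr ?ltr0n// -[X in _ + X]mul1r -mulrDl natr1.
    rewrite mulrAC -natrM [leRHS]mulrC; apply: ler_wpM2l => //.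
    by rewrite ler_nat ltnW// ltn_ceil.
  have : (n %/ m)%:R * u m <= u n.
    apply: le_trans (u_mul _ _) _; rewrite {2}(divn_eq n m).
    by apply: le_trans (u_super _ _); rewrite lerDl.
  lra.
have : u m / n%:R <= e / 2.
  rewrite ler_pdivrMr// mulrC -ler_pdivrMr ?divr_gt0//.
  by near: n; exact: nbhs_infty_ger.
lra.
Unshelve. all: by end_near. Qed.

Lemma cvg_root_of_supermultiplicative (c : nat -> nat) (B : nat) :
  (forall n, 0 < c n)%N -> (forall m n, c m * c n <= c (m + n))%N ->
  (forall n, c n <= B ^ n)%N ->
  cvgn (fun n => (c n)%:R `^ n%:R^-1 : R).
Proof.
move=> c_gt0 c_super c_le.
have cR n : 0 < (c n)%:R :> R by rewrite ltr0n.
have cvgu : cvgn (fun n => ln (c n)%:R / n%:R : R).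
  have B_gt0 : (0 < B)%N by
    have := leq_trans (c_gt0 1%N) (c_le 1%N); rewrite expn1.
  apply: (@superadditive_cvg _ (ln B%:R)) => [n|m n|n].
  - by apply: ln_ge0; rewrite ler1n.
  - by rewrite -lnM ?posrE// -natrM ler_ln ?posrE ?ltr0n ?muln_gt0 ?c_gt0//
    ler_nat.
  - rewrite mulr_natl -lnXn ?ltr0n// -natrX ler_ln ?posrE// ?ltr0n ?expn_gt0
    ?B_gt0//.
    by rewrite ler_nat.
have -> : (fun n => (c n)%:R `^ n%:R^-1 : R) =
    expR \o (fun n => ln (c n)%:R / n%:R).
  by apply/funext => n /=; rewrite /powR gt_eqF// mulrC.
apply/cvg_ex; exists (expR (limn (fun n => ln (c n)%:R / n%:R : R))).
by apply: continuous_cvg => //; exact: continuous_expR.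
Qed.

(** Reduces bounds on a rational power to a comparison of natural powers. *)
Lemma powR_bounds (a lo hi : R) (n k : nat) : (0 < k)%N -> 0 <= a -> 0 <= lo ->
  0 <= hi -> lo ^+ k <= a ^+ n <= hi ^+ k -> lo <= a `^ (n%:R / k%:R) <= hi.
Proof.
move=> k_gt0 a0 lo0 hi0.
suff -> : a ^+ n = (a `^ (n%:R / k%:R)) ^+ k.
  by rewrite !ler_pXn2r ?nnegrE ?powR_ge0.
by rewrite -[RHS]powR_mulrn ?powR_ge0// -powRrM divfK ?powR_mulrn// pnatr_eq0
  -lt0n.
Qed.

Lemma powR_200_approx : `|200 `^ (5 / 18) - 436 / 100 : R| <= 5 / 1000.
Proof.
have : (871 / 200 : R) <= (200 : R) `^ (5%:R / 18%:R) <= 873 / 200.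
  apply: powR_bounds; [by []|lra|lra|lra|].
  by apply/andP; split; lra.
by case/andP => h1 h2; rewrite ler_norml; apply/andP; split; lra.
Qed.

End Growth.

Theorem theorem6 (R : realType) :
  [/\ cvgn (growth_seq R 2 (star 4)),
      (growth R 2 (star 4) <= (200 `^ (5 / 18))%:E)%E
    & `|200 `^ (5 / 18) - 436 / 100 : R| <= 5 / 1000].
Proof.
have cvg_gs : cvgn (growth_seq R 2 (star 4)).
  have cvg_root : cvgn (fun n =>
    (max_colorings 2 (star 4) n)%:R `^ n%:R^-1 : R).
    (* Any exponential bound gives convergence; 200 works because 10 is at most 36. *)
    apply: (@cvg_root_of_supermultiplicative _ _ 200).
    - exact: max_colorings_gt0.
    - exact: max_colorings_supermultiplicative.
    - move=> n; rewrite -(ler_nat R) -(@ler_pXn2r _ 36)// ?nnegrE//.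
      apply: le_trans (max_colorings_le R n) _.
      rewrite natrX -!exprM; apply: ler_weXn2l; first by lra.
      lia.
  by apply/cvg_ex; eexists; apply: cvg_EFin; [exact: nearW | exact: cvg_root].
split=> //; last exact: powR_200_approx.
apply: lime_le => //; near=> n.
have n_gt0 : (0 < n)%N by near: n; exact: nbhs_infty_gt.
rewrite /growth_seq lee_fin.
set c := (_%:R : R).
(* Both sides become powers with exponent 1 / (36 n), using 5/18 = 10/36, so that monotonicity
   reduces the claim to [max_colorings_le]. *)
have -> : (200 : R) `^ (5 / 18) = ((200 ^+ 10) ^+ n) `^ (36 * n)%:R^-1.
  rewrite -powR_mulrn ?exprn_ge0// -powR_mulrn// -!powRrM natrM; congr (_ `^ _).
  by field; rewrite pnatr_eq0 -lt0n.
have -> : c `^ n%:R^-1 = (c ^+ 36) `^ (36 * n)%:R^-1.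
  rewrite -powR_mulrn ?ler0n// -powRrM natrM; congr (_ `^ _).
  by field; rewrite pnatr_eq0 -lt0n.
apply: ge0_ler_powR; rewrite ?nnegrE ?invr_ge0 ?ler0n ?exprn_ge0 ?ler0n//.
exact: max_colorings_le.
Unshelve. all: by end_near. Qed.
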